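(* Let $\{g(x;\theta):\theta\in\Theta\}$ be an exponential family of densities (as defined in the context, with continuous sufficient statistics $\Gamma$). Let $\{\gamma_k\in(0,1]:k=1,2,\dots\}$ be a decreasing sequence of reference values, let $A_k=\{x\in\mathcal{X}:D(x)\le\gamma_k\}$, where $D(x)$ is the domination measure of $x$, and for each $k$ let $\pi_k=\{A_{1,k},\dots,A_{I_k,k}\}$ be a partition of $A_k$ into $U$-measurable sets, where $U$ is the uniform probability measure on the solution space $\mathcal{X}$. Suppose that $$\lim_{k\to\infty}\gamma_k=0\quad\text{and}\quad\lim_{k\to\infty}|\pi_k|=0,\qquad |\pi_k|:=\max_{i}\operatorname{diam}(A_{i,k}).$$ Let $h_{i,k}(x)\propto\mathbf{1}\{x\in A_{i,k}\}$ be the uniform distribution supported on $A_{i,k}$, and let $$\theta_{i,k}=\operatorname*{arg\,min}_{\theta\in\Theta}KL\big(h_{i,k}(\cdot),g(\cdot;\theta)\big).$$ Then for every $x^\ast\in A^\ast=\{x\in\mathcal{X}:D(x)=0\}$ there exists a sequence of sampling distributions $\{g(x;\theta_{i_k,k}):k=1,2,\dots\}$, where $i_k\in\{1,\dots,I_k\}$, such that $$\lim_{k\to\infty}\mathbb{E}_{\theta_{i_k,k}}[\Gamma(x)]=\Gamma(x^\ast).$$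
   Context: **Problem.** Minimize $(f_1(x),\dots,f_n(x))$ over $x\in\mathcal{X}$, where $f_i:\mathcal{X}\to\mathbb{R}$ and the solution space $\mathcal{X}$ is a bounded subset of $\mathbb{R}^d$ that either has non-zero and finite Lebesgue measure or is a finite set. **Domination.** For $x,y\in\mathcal{X}$, $y$ dominates $x$ (written $y\prec_d x$) if $f_i(y)\le f_i(x)$ for all $i=1,\dots,n$ and $f_j(y)<f_j(x)$ for at least one $j$. The set $\mathcal{D}_x=\{y\in\mathcal{X}:y\prec_d x\}$ is assumed to be measurable for every $x\in\mathcal{X}$. **Domination measure.** $D(x)=\nu(\mathcal{D}_x)/\nu(\mathcal{X})$, where $\nu$ is Lebesgue measure on $\mathbb{R}^d$ if $\mathcal{X}$ has non-zero finite Lebesgue measure, and $\nu(S)=|S|/|\mathcal{X}|$ for $S\subseteq\mathcal{X}$ if $\mathcal{X}$ is finite. $A^\ast$, the set of solutions with domination measure zero, is the set of global minimizers of $D$ over $\mathcal{X}$ whenever the minimum value $0$ is attained. **Exponential family.** $\{g(x;\theta):\theta\in\Theta\}$ is an exponential family of densities if $$g(x;\theta)=\exp\{\theta^T\Gamma(x)-\eta(\theta)\},$$ where $\Gamma(x)=[\Gamma_1(x),\dots,\Gamma_{d_\theta}(x)]^T$ is the vector of sufficient statistics, $\eta(\theta)=\ln\int\exp(\theta^T\Gamma(x))\,dx$ is the normalization factor ensuring that $g(\cdot;\theta)$ is a probability density function, and $\Theta=\{\theta:|\eta(\theta)|<\infty\}$ is the natural parameter space, with nonempty interior. $\Gamma(\cdot)$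 is assumed to be a continuous mapping. **Notation.** $\mathbb{E}_\theta[\cdot]$ and $\mathbb{E}_h[\cdot]$ denote expectation with respect to $g(\cdot;\theta)$ and to a distribution $h$. $KL(h,g)=\mathbb{E}_h[\ln(h(x)/g(x))]$ is the Kullback-Leibler divergence. $\operatorname{diam}(A)=\sup_{x,y\in A}\|x-y\|_2$. A partition of $A_k$ is a family of pairwise disjoint sets $A_{1,k},\dots,A_{I_k,k}$ whose union is $A_k$.
   Formalization: Γ is taken continuous on all of R^d, and the densities are either carried by the solution space itself or, on a larger sample space, all KL minimizers θ_{i,k} are assumed interior to Θ; at boundary minimizers the claim as stated can fail. Cells are taken to have positive measure. *)

(* Defs.v *)
From HB Require Import structures.
From mathcomp Require Import all_boot all_order all_algebra finmap.
From mathcomp Require Import all_classical all_reals all_analysis.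

Set Implicit Arguments.
Unset Strict Implicit.
Unset Printing Implicit Defensive.

Import Order.TTheory GRing.Theory Num.Theory.
Import numFieldNormedType.Exports.

Local Open Scope classical_set_scope.
Local Open Scope ring_scope.

(* Points of R^d are row vectors of size d'.+1, so that d = d'.+1 >= 1. *)

Definition box (R : realType) (d : nat) (c : 'rV[R]_d.+1 * 'rV[R]_d.+1) :
  set 'rV[R]_d.+1 := [set x | forall i, c.1 0 i <= x 0 i < c.2 0 i].

Definition box_volume (R : realType) (d : nat)
  (c : 'rV[R]_d.+1 * 'rV[R]_d.+1) : R :=
  \prod_(i < d.+1) Num.max 0 (c.2 0 i - c.1 0 i).

Definition lebesgue_outer (R : realType) (d : nat) (A : set 'rV[R]_d.+1) :
  \bar R :=
  ereal_inf [set (\sum_(0 <= k <oo) (box_volume (F k))%:E)%E |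
    F in [set F : nat -> 'rV[R]_d.+1 * 'rV[R]_d.+1 |
          A `<=` \bigcup_k box (F k)]].

Section lebesgue_outer_is_outer_measure.
Variables (R : realType) (d : nat).
Local Notation mu := (@lebesgue_outer R d).
Local Open Scope ereal_scope.

Lemma box_volume_ge0 (c : 'rV[R]_d.+1 * 'rV[R]_d.+1) : (0 <= box_volume c)%R.
Proof. by apply: prodr_ge0 => i _; rewrite le_max lexx. Qed.

Lemma box_volumee_ge0 (c : 'rV[R]_d.+1 * 'rV[R]_d.+1) :
  0 <= (box_volume c)%:E.
Proof. by rewrite lee_fin box_volume_ge0. Qed.

Lemma lebesgue_outer_ge0 A : 0 <= mu A.
Proof.
apply: le_ereal_inf_tmp => _ [F _ <-]; apply: nneseries_ge0 => k _ _.
exact: box_volumee_ge0.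
Qed.

Lemma lebesgue_outer0 : mu set0 = 0.
Proof.
apply/eqP; rewrite eq_le lebesgue_outer_ge0 andbT.
apply: ereal_inf_lbound => /=; exists (fun=> (0, 0)%R) => //.
rewrite eseries0// => k _ _; rewrite /box_volume big_ord_recl/= subrr maxxx.
by rewrite mul0r.
Qed.

Lemma le_lebesgue_outer : {homo mu : A B / A `<=` B >-> A <= B}.
Proof.
move=> A B AB; apply: ereal_inf_le_tmp => _ [F BF <-]; exists F => //.
exact: subset_trans BF.
Qed.

Lemma lebesgue_outer_sigma_subadditive : sigma_subadditive mu.
Proof.
move=> A; have [[i ioo]|] := pselect (exists i, mu (A i) = +oo).
  rewrite (eseries_pinfty _ _ ioo) ?leey// => n _.
  by rewrite -ltNye (lt_le_trans _ (lebesgue_outer_ge0 _)).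
rewrite -forallNE => Aoo.
suff add2e (e : {posnum R}) :
    mu (\bigcup_n A n) <= \sum_(i <oo) mu (A i) + e%:num%:E.
  by apply/lee_addgt0Pr => _/posnumP[].
rewrite (le_trans _ (epsilon_trick _ _ _))//; last first.
  by move=> n; exact: lebesgue_outer_ge0.
pose vol (c : 'rV[R]_d.+1 * 'rV[R]_d.+1) := (box_volume c)%:E.
pose P n (B : nat -> 'rV[R]_d.+1 * 'rV[R]_d.+1) :=
  A n `<=` \bigcup_k box (B k) /\
  \sum_(k <oo) vol (B k) <= mu (A n) + (e%:num / (2 ^ n.+1)%:R)%:E.
have [G PG] : {G & forall n, P n (G n)}.
  apply: (@choice _ _ P) => n; rewrite /P /lebesgue_outer.
  set S := (X in ereal_inf X); move infS : (ereal_inf S) => iS.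
  case: iS infS => [r Sr|Soo|Soo].
  - have en1 : (0 < e%:num / (2 ^ n.+1)%:R)%R by [].
    have /(lb_ereal_inf_adherent en1) : ereal_inf S \is a fin_num by rewrite Sr.
    move=> [x [B AnB muBx] xS].
    by exists B; split => //; rewrite muBx -Sr; exact/ltW.
  - by have := Aoo n; rewrite /lebesgue_outer Soo.
  - suff : lbound S 0 by move/le_ereal_inf_tmp; rewrite Soo.
    by move=> /= _ [B AnB <-]; apply: nneseries_ge0 => *; exact: box_volumee_ge0.
have volG_ge0 x : 0 <= (vol \o uncurry G) x by exact: box_volumee_ge0.
apply: (@le_trans _ _ (\esum_(i in setT) (vol \o uncurry G) i)).
  apply: ereal_inf_lbound => /=.
  have /card_esym/ppcard_eqP[f] := card_nat2.
  exists (uncurry G \o f).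
    move=> t [i _ Ait]; have [j _ Bijt] := (PG i).1 _ Ait.
    by exists (f^-1%FUN (i, j)) => //=; rewrite invK ?inE.
  rewrite -(esum_pred_image (vol \o uncurry G) _ xpredT) ?[fun=> _]set_true//.
  by rewrite image_eq.
rewrite (_ : esum _ _ = \sum_(i <oo) \sum_(j <oo ) vol (G i j)); last first.
  pose J : nat -> set (nat * nat) := fun i => [set (i, j) | j in setT].
  rewrite (_ : setT = \bigcup_k J k); last first.
    by rewrite predeqE => -[a b]; split => // _; exists a => //; exists b.
  rewrite esum_bigcupT /=; last 2 first.
    - apply/trivIsetP => i j _ _ ij.
      rewrite predeqE => -[n m] /=; split => //= -[] [_] _ [<-{n} _].
      by move=> [m' _] [] /esym/eqP; rewrite (negbTE ij).
    - by move=> /= [n m]; exact: box_volumee_ge0.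
  rewrite -(image_id [set: nat]) -fun_true esum_pred_image//; last first.
    by move=> n _; apply: esum_ge0 => m _; exact: (volG_ge0 m).
  apply: eq_eseriesr => /= j _.
  rewrite -(esum_pred_image (vol \o uncurry G) (pair j) predT)//=; last 2 first.
    by move=> m _; exact: box_volumee_ge0.
    by move=> ? ? _ _; exact: (@can_inj _ _ _ snd).
  by congr esum; rewrite predeqE => -[a b]; split; move=> [i _ <-]; exists i.
apply: lee_lim.
- apply: is_cvg_nneseries => n *.
  by apply: nneseries_ge0 => m *; exact: (volG_ge0 (n, m)).
- apply: is_cvg_nneseries => n *; apply: adde_ge0 => //.
  exact: lebesgue_outer_ge0.
- by near=> n; apply: lee_sum => i _; exact: (PG i).2.
Unshelve. all: by end_near. Qed.

HB.instance Definition _ := isOuterMeasure.Build R 'rV[R]_d.+1 mu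
  lebesgue_outer0 lebesgue_outer_ge0 le_lebesgue_outer
  lebesgue_outer_sigma_subadditive.

End lebesgue_outer_is_outer_measure.

(* R^d equipped with its Lebesgue-measurable (not only Borel) sets. *)
Definition euclid (R : realType) (d : nat) : measurableType _ :=
  caratheodory_type (@lebesgue_outer R d).

Section lebesgue_is_measure.
Variables (R : realType) (d : nat).

Definition lebesgue : set (euclid R d) -> \bar R := @lebesgue_outer R d.

Let lebesgue0 : lebesgue set0 = 0%E.
Proof. exact: lebesgue_outer0. Qed.

Let lebesgue_ge0 A : (0 <= lebesgue A)%E.
Proof. exact: lebesgue_outer_ge0. Qed.

Let lebesgue_semi_sigma_additive : semi_sigma_additive lebesgue.
Proof. exact: caratheodory_measure_sigma_additive. Qed.

HB.instance Definition _ := isMeasure.Build _ _ _ lebesgue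
  lebesgue0 lebesgue_ge0 lebesgue_semi_sigma_additive.

End lebesgue_is_measure.
Arguments lebesgue : clear implicits.

(* The measure nu attached to the solution space X; when X is finite it is
   A |-> |A| / |X| (and +oo on infinite sets, which are not subsets of X). *)
Definition solution_measure (R : realType) (d : nat) (X : set (euclid R d)) :
    {measure set (euclid R d) -> \bar R} :=
  if `[< finite_set X >] then
    (mscale (#|` fset_set X|%:R^-1)%:nng (@counting (euclid R d) R)
      : {measure set (euclid R d) -> \bar R})
  else (lebesgue R d : {measure set (euclid R d) -> \bar R}).

Definition solution_space (R : realType) (d : nat) (X : set (euclid R d)) :=
  bounded_set (X : set 'rV[R]_d.+1) /\
  (finite_set X \/
   [/\ measurable X, (0 < lebesgue R d X)%E & (lebesgue R d X < +oo)%E]).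

Section domination.
Variables (R : realType) (d n : nat).
Variables (X : set (euclid R d)) (f : 'I_n -> euclid R d -> R).

Definition dominates (y x : euclid R d) : Prop :=
  (forall i, f i y <= f i x) /\ (exists j, f j y < f j x).

Definition dominating_set (x : euclid R d) : set (euclid R d) :=
  [set y | X y /\ dominates y x].

Definition domination_measure (x : euclid R d) : R :=
  fine (solution_measure X (dominating_set x)) / fine (solution_measure X X).

Definition level_set (c : R) : set (euclid R d) :=
  [set x | X x /\ domination_measure x <= c].

Definition optimal_set : set (euclid R d) :=
  [set x | X x /\ domination_measure x = 0].

End domination.

(* The norm of the normed module 'rV[R]_d is the sup norm. *)
Definition norm2 (R : realType) (d : nat) (x : 'rV[R]_d) : R :=
  Num.sqrt (\sum_(i < d) x 0 i ^+ 2).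

Definition diam (R : realType) (d : nat) (A : set 'rV[R]_d) : \bar R :=
  ereal_sup [set (norm2 (u.1 - u.2))%:E | u in A `*` A].

Definition mesh (R : realType) (d m : nat) (A : 'I_m -> set 'rV[R]_d) :
  \bar R := \big[Order.max/0%E]_(i < m) diam (A i).

(* Densities are with respect to mu and carried by Omega: the solution space
   itself, or a larger region such as R^d.  When Omega is bounded and Gamma is
   continuous on R^d, natural_parameters is open (it is everything as soon as
   0 < mu Omega < +oo); when Omega is unbounded it may contain boundary
   points, at which a KL minimizer need not satisfy the moment equation. *)
Section densities.
Variables (R : realType) (dT : measure_display) (T : measurableType dT).
Variables (mu : {measure set T -> \bar R}) (Omega : set T).

Definition expect (h : T -> R) (F : T -> R) : \bar R :=
  (\int[mu]_(x in Omega) (F x * h x)%:E)%E.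

Definition uniform_density (A : set T) (x : T) : R :=
  \1_A x / fine (mu A).

Definition KL (h g : T -> R) : \bar R :=
  expect h (fun x => ln (h x / g x)).

Variables (p : nat) (Gamma : T -> 'rV[R]_p).

Definition dotp (u v : 'rV[R]_p) : R := \sum_(j < p) u 0 j * v 0 j.

Definition log_partition (theta : 'rV[R]_p) : \bar R :=
  lne (\int[mu]_(x in Omega) (expR (dotp theta (Gamma x)))%:E)%E.

Definition natural_parameters : set 'rV[R]_p :=
  [set theta | log_partition theta \is a fin_num].

Definition exp_density (theta : 'rV[R]_p) (x : T) : R :=
  expR (dotp theta (Gamma x) - fine (log_partition theta)).

Definition is_argmin_KL (h : T -> R) (theta : 'rV[R]_p) : Prop :=
  natural_parameters theta /\
  forall t, natural_parameters t ->
    (KL h (exp_density theta) <= KL h (exp_density t))%E.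

End densities.

(* Main.v *)
(* Every cell [A_{i,k}] lies in [X], and some cell contains [xstar] because
   [D xstar = 0 <= gamma_k]; choose that cell.  At an interior parameter the
   minimality of the Kullback-Leibler divergence forces the moment equation
   [E_theta[Gamma_j] = m], where [m] is the mean of [Gamma_j] under the uniform
   law on the cell; since the cells shrink to [xstar] and [Gamma] is continuous,
   these means tend to [Gamma_j xstar].  When the densities are carried by the
   bounded set [X], every parameter is interior.

   The moment equation is obtained without differentiating under the integral:
   with [Y = Gamma_j - m], minimality gives [E_theta[expR (s Y)] >= 1] for all
   small [s] of either sign, and [expR u <= 1 + u + u^2 expR |u|] bounds the
   left side by [1 + s E_theta[Y] + O(s^2)], so that [E_theta[Y] = 0]. *)

Require Import Defs.
From HB Require Import structures.
From mathcomp Require Import all_boot all_order all_algebra.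
From mathcomp Require Import all_classical all_reals all_analysis.
From mathcomp Require Import measurable_realfun.
From mathcomp Require Import lra ring.

Set Implicit Arguments.
Unset Strict Implicit.
Unset Printing Implicit Defensive.

Import Order.TTheory GRing.Theory Num.Theory.
Import numFieldNormedType.Exports.

Local Open Scope classical_set_scope.
Local Open Scope ring_scope.

(** * Borel sets and continuous functions are Lebesgue measurable *)

Section euclid_borel.
Variables (R : realType) (d : nat).
Implicit Types (c : 'rV[R]_d.+1 * 'rV[R]_d.+1) (i : 'I_d.+1) (a : R).

(** [box_lt] and [box_ge] are the pieces of a box on the two sides of the hyperplane [x 0 i = a]. If
    the hyperplane misses the box, one piece has a side of nonpositive length, which [box_volume]
    counts as 0. *)
Definition box_lt i a c : 'rV[R]_d.+1 * 'rV[R]_d.+1 :=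
  (c.1, \row_j (if j == i then Num.min (c.2 0 j) a else c.2 0 j)).

Definition box_ge i a c : 'rV[R]_d.+1 * 'rV[R]_d.+1 :=
  (\row_j (if j == i then Num.max (c.1 0 j) a else c.1 0 j), c.2).

Lemma box_ltE i a c x : box c x -> x 0 i < a -> box (box_lt i a c) x.
Proof.
move=> cx xa j; rewrite !mxE; have /andP[-> xc2] := cx j.
by case: eqP => [->|//]; rewrite lt_min xa andbT; have /andP[] := cx i.
Qed.

Lemma box_geE i a c x : box c x -> a <= x 0 i -> box (box_ge i a c) x.
Proof.
move=> cx xa j; rewrite !mxE; have /andP[c1x ->] := cx j; rewrite andbT.
by case: eqP => [->|//]; rewrite ge_max xa andbT; have /andP[] := cx i.
Qed.

(** Only the side along [i] is cut: the other factors come out of the product, and the truncated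
    lengths of the two pieces add up for every position of [a]. *)
Lemma box_volume_split i a c :
  box_volume (box_lt i a c) + box_volume (box_ge i a c) = box_volume c.
Proof.
rewrite /box_volume (bigD1 i)//= [in X in _ + X](bigD1 i)//=.
rewrite [in RHS](bigD1 i)//= !mxE eqxx.
have eq_lt : \prod_(j < d.+1 | j != i)
    Num.max 0 ((box_lt i a c).2 0 j - (box_lt i a c).1 0 j) =
    \prod_(j < d.+1 | j != i) Num.max 0 (c.2 0 j - c.1 0 j).
  by apply: eq_bigr => j /negbTE ji; rewrite !mxE ji.
have eq_ge : \prod_(j < d.+1 | j != i)
    Num.max 0 ((box_ge i a c).2 0 j - (box_ge i a c).1 0 j) =
    \prod_(j < d.+1 | j != i) Num.max 0 (c.2 0 j - c.1 0 j).
  by apply: eq_bigr => j /negbTE ji; rewrite !mxE ji.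
rewrite eq_lt eq_ge -mulrDl; congr (_ * _).
case: (leP (c.2 0 i) a) => ?; case: (leP (c.1 0 i) a) => ?;
  rewrite /Num.max; repeat case: ifPn; rewrite -?leNgt; lra.
Qed.

(** Carathéodory's criterion is checked cover by cover: cutting each box of a cover of [A] along the
    hyperplane yields covers of both parts of [A], with the same total volume. *)
Lemma measurable_halfspace i a :
  measurable ([set x : 'rV[R]_d.+1 | x 0 i < a] : set (euclid R d)).
Proof.
apply: le_caratheodory_measurable => A.
set H := [set x : 'rV[R]_d.+1 | x 0 i < a].
apply: le_ereal_inf_tmp => _ [F AF <-].
have coverL : (lebesgue_outer (A `&` H) <=
    \sum_(0 <= k <oo) (box_volume (box_lt i a (F k)))%:E)%E.
  apply: ereal_inf_lbound; exists (box_lt i a \o F) => //.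
  by move=> x [/AF[k _ Fkx] xa]; exists k => //; exact: box_ltE.
have coverR : (lebesgue_outer (A `&` ~` H) <=
    \sum_(0 <= k <oo) (box_volume (box_ge i a (F k)))%:E)%E.
  apply: ereal_inf_lbound; exists (box_ge i a \o F) => //.
  move=> x [/AF[k _ Fkx] xa]; exists k => //; apply: box_geE => //.
  by rewrite leNgt; exact/negP.
apply: (le_trans (leeD coverL coverR)).
rewrite -nneseriesD; try by move=> k _ _; exact: box_volumee_ge0.
by under eq_eseriesr do rewrite -EFinD box_volume_split.
Qed.

Lemma measurable_box c : measurable (box c : set (euclid R d)).
Proof.
have -> : box c = \bigcap_(i in [set: 'I_d.+1])
    (~` [set x : 'rV[R]_d.+1 | x 0 i < c.1 0 i] `&`
     [set x | x 0 i < c.2 0 i]).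
  apply/seteqP; split => [x cx i _|x cx i].
    by have /andP[cxi xci] := cx i; split => //=; apply/negP; rewrite -leNgt.
  by have [/= /negP + ->] := cx i I; rewrite -leNgt andbT.
rewrite -[X in measurable X]setCK setC_bigcap; apply: measurableC.
apply: (@countable_bigcupT_measurable _ (euclid R d)) => [|i].
  exact: countableP.
apply: measurableC; apply: measurableI; [apply: measurableC|];
  exact: measurable_halfspace.
Qed.

(** An open set is the union of the boxes with rational corners that it contains. Boxes not
    contained in [U] are replaced by [set0], so that the index set is a whole countable type. *)
Lemma open_measurable_euclid (U : set 'rV[R]_d.+1) :
  open U -> measurable (U : set (euclid R d)).
Proof.
move=> oU.
pose bx (q : 'rV[rat]_d.+1 * 'rV[rat]_d.+1) : 'rV[R]_d.+1 * 'rV[R]_d.+1 :=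
  (map_mx ratr q.1, map_mx ratr q.2).
have -> : U = \bigcup_(q in [set: 'rV[rat]_d.+1 * 'rV[rat]_d.+1])
    (if `[< box (bx q) `<=` U >] then box (bx q) else set0).
  apply/seteqP; split => [x Ux|x [q _]]; last first.
    by case: ifPn => // /asboolP; exact.
  have /nbhs_ballP[e /= e0 xeU] := oU _ Ux.
  (* Corners within [e] of [x] in each coordinate keep the box inside the ball of radius [e], since
     balls here are sup-norm balls. *)
  have /choice[l xl] : forall i, exists q : rat,
      x 0 i - e < ratr q < x 0 i.
    move=> i; have : x 0 i - e < x 0 i by lra.
    by move=> /rat_in_itvoo[q]; rewrite in_itv/=; exists q.
  have /choice[r xr] : forall i, exists q : rat,
      x 0 i < ratr q < x 0 i + e.
    move=> i; have : x 0 i < x 0 i + e by lra.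
    by move=> /rat_in_itvoo[q]; rewrite in_itv/=; exists q.
  exists (\row_i l i, \row_i r i) => //.
  rewrite ifT.
    move=> i; rewrite !mxE; have /andP[_ ?] := xl i; have /andP[? _] := xr i.
    by apply/andP; split => //; exact: ltW.
  apply/asboolP => y ylr; apply: xeU; split => // i j.
  rewrite ord1 /ball/=; have := ylr j; rewrite !mxE.
  have := xl j; have := xr j; rewrite ltr_norml; lra.
apply: (@countable_bigcupT_measurable _ (euclid R d)) => [|q].
  exact: countableP.
by case: ifP => _; [exact: measurable_box|exact: measurable0].
Qed.

Lemma continuous_measurable_euclid (g : 'rV[R]_d.+1 -> R) :
  continuous g -> measurable_fun setT (g : euclid R d -> R).
Proof.
move=> cg; apply: (measurability _ (RGenOpens.measurableE R)).
move=> _ [_ [a [b ->] <-]].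
rewrite setTI; apply: open_measurable_euclid.
by apply: open_comp => // x _; exact: cg.
Qed.

End euclid_borel.

(** * Elementary inequalities for the exponential *)

Section exponential_estimates.
Variable R : realType.
Implicit Types u y s e : R.

(** The bound [expR u - 1 <= u * expR u], used twice, settles [0 <= u]; for negative [u],
    [u <= expR u - 1] gives [u * (expR u - 1) <= u ^+ 2]. *)
Lemma expR_le_quadratic u : expR u <= 1 + u + u ^+ 2 * expR `|u|.
Proof.
have tangent : expR u - 1 <= u * expR u.
  have : expR u * (1 - u) <= expR u * expR (- u).
    by rewrite ler_wpM2l ?expR_ge0// expR_ge1Dx.
  by rewrite -expRD subrr expR0; lra.
suff : u * (expR u - 1) <= u ^+ 2 * expR `|u| by lra.
have [u0|u0] := leP 0 u.
  by rewrite (ger0_norm u0) expr2 -mulrA ler_wpM2l.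
have := expR_ge1Dx u; have : 1 <= expR `|u| by rewrite -expR0 ler_expR.
by nra.
Qed.

Lemma expR_norm_le y : expR `|y| <= expR y + expR (- y).
Proof.
have := expR_ge0 y; have := expR_ge0 (- y).
by case: (ger0P y) => _; lra.
Qed.

(** This is [1 + z <= expR z] at [z = e * |y|]. It serves to dominate a linear factor by two
    exponential tilts. *)
Lemma norm_le_expR y e : 0 < e ->
  `|y| <= e^-1 * (expR (e * y) + expR (- e * y)).
Proof.
move=> e0; rewrite mulrC ler_pdivlMr//.
rewrite mulNr; apply: le_trans (expR_norm_le _).
rewrite normrM (gtr0_norm e0) mulrC.
by have := expR_ge1Dx (e * `|y|); lra.
Qed.

(** The exponent [e * |y|], equal to [4 * w], is shared: one half bounds [expR |s * y|], the other
    half absorbs the square through [w <= expR w]. *)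
Lemma sqr_expR_le y s e : 0 < e -> `|s| <= e / 2 ->
  y ^+ 2 * expR `|s * y| <= (4 / e) ^+ 2 * (expR (e * y) + expR (- e * y)).
Proof.
move=> e0 se; pose w := e / 4 * `|y|.
have w0 : 0 <= w by rewrite mulr_ge0// divr_ge0// ltW.
have -> : y ^+ 2 = (4 / e) ^+ 2 * w ^+ 2.
  rewrite /w -real_normK ?num_real// -exprMn mulrA.
  by rewrite [X in X * _](_ : _ = 1) ?mul1r//; field; rewrite gt_eqF.
rewrite -mulrA ler_wpM2l ?sqr_ge0//.
have wexp : w ^+ 2 <= expR w ^+ 2.
  by rewrite ler_sqr ?nnegrE ?expR_ge0//; have := expR_ge1Dx w; lra.
have sy : expR `|s * y| <= expR w ^+ 2.
  rewrite -expRM_natl ler_expR normrM /w.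
  apply: (@le_trans _ _ (e / 2 * `|y|)); first by rewrite ler_wpM2r.
  by rewrite le_eqVlt; apply/orP; left; apply/eqP; field.
apply: (@le_trans _ _ (expR w ^+ 2 * expR w ^+ 2)).
  by rewrite ler_pM ?sqr_ge0 ?expR_ge0.
rewrite -exprD -expRM_natl mulNr.
have -> : (2 + 2)%:R * w = `|e * y|.
  by rewrite /w normrM (gtr0_norm e0); field.
exact: expR_norm_le.
Qed.

(** For small [s] the linear term prevails, so its slope cannot be negative; replacing [s] by [- s]
    gives the same for [- a]. *)
Lemma linear_quadratic_ge0 (a b e : R) : 0 < e ->
  (forall s, `|s| <= e -> 0 <= s * a + s ^+ 2 * b) -> a = 0.
Proof.
move=> e0 ab.
have slope_ge0 c : (forall s, `|s| <= e -> 0 <= s * c + s ^+ 2 * b) -> 0 <= c.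
  move=> cb; rewrite leNgt; apply/negP => c0.
  (* At this [s], [s * |b|] is less than [- c / 2], so [c + s * b] would be negative. *)
  pose s := Num.min e (- c / (2 * (`|b| + 1))).
  have b1 : 0 < 2 * (`|b| + 1) by have := normr_ge0 b; lra.
  have s0 : 0 < s by rewrite lt_min e0 divr_gt0//; lra.
  have sc : s * (2 * (`|b| + 1)) <= - c.
    by rewrite -ler_pdivlMr// ge_min lexx orbT.
  have /cb : `|s| <= e by rewrite (gtr0_norm s0) ge_min lexx.
  rewrite expr2 -mulrA -mulrDr pmulr_rge0//.
  have : s * b <= s * `|b| by rewrite ler_pM2l// ler_norm.
  nra.
apply/eqP; rewrite eq_le slope_ge0// andbT -oppr_ge0 slope_ge0// => s se.
by have := ab (- s); rewrite normrN sqrrN mulNr mulrN; exact.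
Qed.

End exponential_estimates.

(** * First-order condition for exponential tilts of a weight *)

Section tilting.
Context d (T : measurableType d) (R : realType).
Variables (mu : {measure set T -> \bar R}) (D : set T) (mD : measurable D).

(** The extreme tilts [s = e] and [s = - e] add up to an integrable [B] that dominates, up to
    constants, both [w * Y] and the second-order remainder. Integrating the quadratic bound on
    [expR] then leaves a nonnegative linear-plus-quadratic function of [s], whose slope must
    vanish. *)
Lemma integral_tilt_critical (w Y : T -> R) (e : R) :
  measurable_fun D w -> measurable_fun D Y -> (forall x, 0 <= w x) -> 0 < e ->
  (forall s, `|s| <= e ->
    mu.-integrable D (EFin \o (fun x => w x * expR (s * Y x))) /\
    \int[mu]_(x in D) w x <= \int[mu]_(x in D) (w x * expR (s * Y x))) ->
  mu.-integrable D (EFin \o (fun x => w x * Y x)) /\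
  \int[mu]_(x in D) (w x * Y x) = 0.
Proof.
move=> mw mY w0 e0 tilt.
have ee : `|e| <= e by rewrite gtr0_norm.
have Nee : `|- e| <= e by rewrite normrN.
pose B x := w x * expR (e * Y x) + w x * expR (- e * Y x).
have iB : mu.-integrable D (EFin \o B).
  exact: (integrableD mD (tilt _ ee).1 (tilt _ Nee).1).
have iw : mu.-integrable D (EFin \o w).
  have [|+ _] := tilt 0; first by rewrite normr0 ltW.
  by apply: eq_integrable => // x _ /=; rewrite mul0r expR0 mulr1.
have iwY : mu.-integrable D (EFin \o (fun x => w x * Y x)).
  apply: (@le_integrable _ _ _ mu D mD _ (EFin \o (fun x => e^-1 * B x))).
  - by apply/measurable_EFinP; exact: measurable_funM.
  - move=> x _ /=; rewrite lee_fin normrM (ger0_norm (w0 x)).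
    apply: le_trans (ler_norm _).
    by rewrite /B -mulrDr mulrCA ler_wpM2l// norm_le_expR.
  - exact: (integrableZl mD e^-1 iB).
(* Only [|s| <= e / 2] is used, so that half of the exponent [e] remains to absorb [Y ^+ 2]. *)
split=> //; apply: (@linear_quadratic_ge0 _ _
    ((4 / e) ^+ 2 * \int[mu]_(x in D) B x) (e / 2)); first by lra.
move=> s se2; have se : `|s| <= e by lra.
have isY : mu.-integrable D (EFin \o (fun x => s * (w x * Y x))).
  exact: (integrableZl mD s iwY).
have isB : mu.-integrable D (EFin \o (fun x => s ^+ 2 * (4 / e) ^+ 2 * B x)).
  exact: (integrableZl mD _ iB).
have iwsY : mu.-integrable D (EFin \o (fun x => w x + s * (w x * Y x))).
  exact: (integrableD mD iw isY).
have := (tilt s se).2.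
suff : \int[mu]_(x in D) (w x * expR (s * Y x)) <=
    \int[mu]_(x in D) (w x + s * (w x * Y x) + s ^+ 2 * (4 / e) ^+ 2 * B x).
  rewrite RintegralD// RintegralD// !RintegralZl//; lra.
apply: le_Rintegral => //; first exact: (tilt s se).1.
  exact: (integrableD mD iwsY isB).
move=> x _.
have -> : w x + s * (w x * Y x) + s ^+ 2 * (4 / e) ^+ 2 * B x = w x *
    (1 + s * Y x + s ^+ 2 *
      ((4 / e) ^+ 2 * (expR (e * Y x) + expR (- e * Y x)))).
  by rewrite /B; ring.
rewrite ler_wpM2l//; apply: le_trans (expR_le_quadratic _) _.
by rewrite lerD2l exprMn -mulrA ler_wpM2l ?sqr_ge0// sqr_expR_le.
Qed.

End tilting.

(** * Expectations under the uniform law on a set of positive finite measure *)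

Section uniform_expectation.
Context d (T : measurableType d) (R : realType).
Variables (mu : {measure set T -> \bar R}) (Omega A : set T).
Hypotheses (mO : measurable Omega) (mA : measurable A) (AO : A `<=` Omega).
Hypotheses (A0 : (0 < mu A)%E) (Aoo : (mu A < +oo)%E).
Local Notation h := (uniform_density mu A).

Lemma fine_measure_gt0 : 0 < fine (mu A).
Proof. by rewrite fine_gt0// A0 Aoo. Qed.

Lemma uniform_density_ge0 x : 0 <= h x.
Proof. by rewrite divr_ge0// ?indicE// ltW// fine_measure_gt0. Qed.

Lemma uniform_density_out x : ~ A x -> h x = 0.
Proof. by move=> Ax; rewrite /uniform_density indicE memNset// mul0r. Qed.

Lemma measurable_uniform_density : measurable_fun Omega h.
Proof.
apply: measurable_funM; last exact: measurable_cst.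
exact: measurable_indic.
Qed.

Lemma integrable_uniform_density : mu.-integrable Omega (EFin \o h).
Proof.
apply/integrableP; split.
  by apply/measurable_EFinP; exact: measurable_uniform_density.
under eq_integral => x _.
  rewrite /= ger0_norm ?uniform_density_ge0// /uniform_density mulrC EFinM.
  over.
rewrite ge0_integralZl//.
- rewrite integral_indic// setIidl// lte_mul_pinfty//.
- by apply/measurable_EFinP; exact: measurable_indic.
Qed.

Lemma Rintegral_uniform_density : \int[mu]_(x in Omega) h x = 1.
Proof.
rewrite /Rintegral; under eq_integral do rewrite /uniform_density mulrC EFinM.
rewrite ge0_integralZl//.
- rewrite integral_indic// setIidl// fineM// ?ge0_fin_numE ?ltW//.
  by rewrite mulVf// gt_eqF// fine_measure_gt0.
- by apply/measurable_EFinP; exact: measurable_indic.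
Qed.

Lemma integrable_uniform_bounded (F : T -> R) (C : R) :
  measurable_fun Omega F -> (forall x, A x -> `|F x| <= C) ->
  mu.-integrable Omega (EFin \o (fun x => F x * h x)).
Proof.
move=> mF FC; apply: (@le_integrable _ _ _ mu Omega mO _
  (EFin \o (fun x => C * h x))).
- apply/measurable_EFinP; apply: measurable_funM => //.
  exact: measurable_uniform_density.
- move=> x _ /=; rewrite lee_fin; have [Ax|Ax] := pselect (A x); last first.
    by rewrite uniform_density_out// !mulr0.
  apply: le_trans (ler_norm _); rewrite normrM.
  rewrite (ger0_norm (uniform_density_ge0 x)) ler_wpM2r ?FC//.
  exact: uniform_density_ge0.
- exact: (integrableZl mO C integrable_uniform_density).
Qed.

(** Since [h] has mass 1, [c] is the integral of [c * h], and the difference is the mean of [F - c],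
    bounded by [e] wherever [h] is nonzero. *)
Lemma expect_uniform_dist (F : T -> R) (c e : R) :
  measurable_fun Omega F -> (forall x, A x -> `|F x - c| <= e) ->
  `|\int[mu]_(x in Omega) (F x * h x) - c| <= e.
Proof.
move=> mF Fce.
have mFc : measurable_fun Omega (fun x => F x - c).
  by apply: measurable_funB => //; exact: measurable_cst.
have iFc := integrable_uniform_bounded mFc Fce.
have iF : mu.-integrable Omega (EFin \o (fun x => F x * h x)).
  apply: (@integrable_uniform_bounded _ (e + `|c|)) => // x Ax.
  rewrite -[F x](subrK c); apply: le_trans (ler_normD _ _) _.
  by rewrite lerD2r Fce.
have ich : mu.-integrable Omega (EFin \o (fun x => c * h x)).
  exact: (integrableZl mO c integrable_uniform_density).
have ieh : mu.-integrable Omega (EFin \o (fun x => e * h x)).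
  exact: (integrableZl mO e integrable_uniform_density).
have -> : \int[mu]_(x in Omega) (F x * h x) - c =
    \int[mu]_(x in Omega) ((F x - c) * h x).
  rewrite -[in LHS](mulr1 c) -Rintegral_uniform_density.
  rewrite -RintegralZl//; last exact: integrable_uniform_density.
  by rewrite -RintegralB//; apply: eq_Rintegral => x _; rewrite mulrBl.
apply: le_trans (le_normr_Rintegral _ _) _ => //.
rewrite -[leRHS]mulr1 -Rintegral_uniform_density.
rewrite -RintegralZl//; last exact: integrable_uniform_density.
apply: le_Rintegral => //; first exact: (integrable_norm iFc).
move=> x _; have [Ax|Ax] := pselect (A x); last first.
  by rewrite uniform_density_out// !mulr0 normr0.
rewrite normrM (ger0_norm (uniform_density_ge0 x)).
by rewrite ler_wpM2r ?uniform_density_ge0// Fce.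
Qed.

End uniform_expectation.

(** * Partition function, divergence and moment equation *)

Section moment_equation.
Context d (T : measurableType d) (R : realType).
Variables (mu : {measure set T -> \bar R}) (Omega : set T).
Variables (p : nat) (Gamma : T -> 'rV[R]_p).
Hypothesis mO : measurable Omega.
Hypothesis mGamma : forall j, measurable_fun Omega (fun x => Gamma x 0 j).
Local Notation Theta := (natural_parameters mu Omega Gamma).
Local Notation weight t := (fun x => expR (dotp t (Gamma x))).
Local Notation Z t := (\int[mu]_(x in Omega) weight t x).

Lemma dotpDl (t u v : 'rV[R]_p) : dotp (t + u) v = dotp t v + dotp u v.
Proof.
by rewrite /dotp -big_split; apply: eq_bigr => j _; rewrite mxE mulrDl.
Qed.

Lemma dotpZdelta (s : R) (j : 'I_p) (v : 'rV[R]_p) :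
  dotp (s *: delta_mx 0 j) v = s * v 0 j.
Proof.
rewrite /dotp (bigD1 j)//= !mxE !eqxx mulr1 big1 ?addr0// => i /negbTE ij.
by rewrite !mxE ij andbF mulr0 mul0r.
Qed.

Lemma norm_dotp_le (t v : 'rV[R]_p) (C : R) :
  (forall j, `|v 0 j| <= C) -> `|dotp t v| <= \sum_(j < p) `|t 0 j| * C.
Proof.
move=> vC; apply: le_trans (ler_norm_sum _ _ _) _.
by apply: ler_sum => j _; rewrite normrM ler_wpM2l.
Qed.

Lemma measurable_dotp (t : 'rV[R]_p) :
  measurable_fun Omega (fun x => dotp t (Gamma x)).
Proof.
by apply: measurable_sum => j; exact: measurable_funM.
Qed.

Lemma measurable_weight (t : 'rV[R]_p) : measurable_fun Omega (weight t).
Proof. exact: measurableT_comp (measurable_dotp t). Qed.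

(** As [lne] maps [+oo] to [+oo], a finite log-partition excludes an infinite integral, so [fine]
    loses nothing in [Z t]. *)
Lemma integral_weightE (t : 'rV[R]_p) : Theta t ->
  (\int[mu]_(x in Omega) (weight t x)%:E)%E = (Z t)%:E.
Proof.
rewrite /natural_parameters /log_partition /= /Rintegral.
have : (0 <= \int[mu]_(x in Omega) (weight t x)%:E)%E.
  by apply: integral_ge0 => x _; rewrite lee_fin expR_ge0.
by case: (integral _ _ _).
Qed.

(** A zero integral would have [lne] equal to [-oo], which is not a finite number. *)
Lemma partition_gt0 (t : 'rV[R]_p) : Theta t -> 0 < Z t.
Proof.
move=> Tt; have := Tt; rewrite /natural_parameters /log_partition /=.
rewrite (integral_weightE Tt).
by case: (ltP 0 (Z t)) => // Z0; rewrite le0_lneNy.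
Qed.

Lemma log_partitionE (t : 'rV[R]_p) : Theta t ->
  fine (log_partition mu Omega Gamma t) = ln (Z t).
Proof.
move=> Tt; rewrite /log_partition (integral_weightE Tt) lne_EFin//.
exact: partition_gt0.
Qed.

Lemma integrable_weight (t : 'rV[R]_p) : Theta t ->
  mu.-integrable Omega (EFin \o weight t).
Proof.
move=> Tt; apply/integrableP; split.
  by apply/measurable_EFinP; exact: measurable_weight.
under eq_integral => x _ do rewrite /= ger0_norm ?expR_ge0//.
by rewrite (integral_weightE Tt) ltry.
Qed.

Lemma interior_direction (t : 'rV[R]_p) (j : 'I_p) : interior Theta t ->
  exists2 e : R, 0 < e & forall s, `|s| <= e -> Theta (t + s *: delta_mx 0 j).
Proof.
move=> /nbhs_ballP[e /= e0 teT]; exists (e / 2); first by rewrite divr_gt0.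
move=> s se; apply: teT; split=> // i k; rewrite !mxE.
rewrite /ball/= opprD addNKr normrN normrM.
have : `|((i == 0) && (k == j))%:R : R| <= 1.
  by case: (_ && _); rewrite ?normr1 ?normr0.
by have := normr_ge0 s; nra.
Qed.

Variable A : set T.
Hypotheses (mA : measurable A) (AO : A `<=` Omega).
Hypotheses (A0 : (0 < mu A)%E) (Aoo : (mu A < +oo)%E).
Hypothesis bGamma :
  exists C : R, forall j x, A x -> `|Gamma x 0 j| <= C.
Local Notation h := (uniform_density mu A).
Local Notation mean F := (\int[mu]_(x in Omega) (F x * h x)).

Lemma integrable_uniform_Gamma (j : 'I_p) :
  mu.-integrable Omega (EFin \o (fun x => Gamma x 0 j * h x)).
Proof.
have [C GC] := bGamma.
exact: integrable_uniform_bounded (mGamma j) (GC j).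
Qed.

Lemma integrable_uniform_dotp (t : 'rV[R]_p) :
  mu.-integrable Omega (EFin \o (fun x => dotp t (Gamma x) * h x)).
Proof.
have [C GC] := bGamma.
have bound x : A x -> `|dotp t (Gamma x)| <= \sum_(j < p) `|t 0 j| * C.
  by move=> Ax; apply: norm_dotp_le => j; exact: GC.
exact: integrable_uniform_bounded (measurable_dotp t) bound.
Qed.

(** On [A] the log-ratio is the constant [a] minus [dotp t (Gamma x)]; off [A] the factor [h] is 0,
    whatever [ln] returns there. The first term of the result does not depend on [t]. *)
Lemma KL_uniformE (t : 'rV[R]_p) : Theta t ->
  KL mu Omega h (exp_density mu Omega Gamma t) =
  (ln (fine (mu A))^-1 + ln (Z t) - mean (fun x => dotp t (Gamma x)))%:E.
Proof.
move=> Tt; pose a := ln (fine (mu A))^-1 + ln (Z t).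
have iah : mu.-integrable Omega (EFin \o (fun x => a * h x)).
  exact: (integrableZl mO a (integrable_uniform_density mO mA AO Aoo)).
have iL := integrable_uniform_dotp t.
have -> : a - mean (fun x => dotp t (Gamma x)) =
    \int[mu]_(x in Omega) (a * h x - dotp t (Gamma x) * h x).
  rewrite RintegralB// RintegralZl//; last exact: integrable_uniform_density.
  by rewrite Rintegral_uniform_density// mulr1.
rewrite /Rintegral fineK; last first.
  by apply: integrable_fin_num => //; exact: (integrableB mO iah iL).
apply: eq_integral => x _; congr EFin.
have [Ax|Ax] := pselect (A x); last first.
  by rewrite uniform_density_out// !mulr0 subr0.
rewrite -mulrBl; congr (_ * _).
rewrite {1}/uniform_density indicE mem_set// mul1r /exp_density.
rewrite ln_div ?posrE ?invr_gt0 ?fine_measure_gt0 ?expR_gt0//.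
by rewrite expRK log_partitionE// /a; lra.
Qed.

(* Along [theta + s e_j] the divergence is, up to a constant,
   [ln (Z (theta + s e_j)) - s m]; its minimality at [s = 0] says that tilting
   the weight by [expR (s * (Gamma_j - m))] does not decrease its integral. *)
Lemma argmin_KL_tilt (theta : 'rV[R]_p) (j : 'I_p) (s : R) :
  is_argmin_KL mu Omega Gamma h theta -> Theta (theta + s *: delta_mx 0 j) ->
  Z theta <= expR (- s * mean (fun x => Gamma x 0 j)) *
             Z (theta + s *: delta_mx 0 j).
Proof.
move=> [Tt mint] Ts; have := mint _ Ts; rewrite !KL_uniformE// lee_fin.
have -> : mean (fun x => dotp (theta + s *: delta_mx 0 j) (Gamma x)) =
    mean (fun x => dotp theta (Gamma x)) + s * mean (fun x => Gamma x 0 j).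
  have iG := integrable_uniform_Gamma j.
  rewrite -RintegralZl// -RintegralD//.
  - apply: eq_Rintegral => x _ /=.
    by rewrite dotpDl dotpZdelta mulrDl mulrA.
  - exact: integrable_uniform_dotp.
  - exact: (integrableZl mO s iG).
move=> le_ln.
rewrite -ler_ln ?posrE ?mulr_gt0 ?expR_gt0 ?partition_gt0//.
rewrite lnM ?posrE ?expR_gt0 ?partition_gt0// expRK; lra.
Qed.

(** Interiority makes [weight theta] tilted by [Gamma_j - m] integrable for small [s] of both signs,
    and [argmin_KL_tilt] is then the inequality that [integral_tilt_critical] asks for. *)
Lemma argmin_KL_moment (theta : 'rV[R]_p) (j : 'I_p) :
  is_argmin_KL mu Omega Gamma h theta -> interior Theta theta ->
  expect mu Omega (exp_density mu Omega Gamma theta) (fun x => Gamma x 0 j) =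
  (mean (fun x => Gamma x 0 j))%:E.
Proof.
move=> argmin /(interior_direction j)[e e0 Te].
have Tt := argmin.1; set m := mean (fun x => Gamma x 0 j).
have tiltE s x : weight theta x * expR (s * (Gamma x 0 j - m)) =
    expR (- s * m) * weight (theta + s *: delta_mx 0 j) x.
  by rewrite -!expRD dotpDl dotpZdelta; congr expR; ring.
have [] := @integral_tilt_critical _ _ _ mu Omega mO (weight theta)
    (fun x => Gamma x 0 j - m) e.
- exact: measurable_weight.
- by apply: measurable_funB => //; exact: measurable_cst.
- by move=> x; rewrite expR_ge0.
- exact: e0.
- move=> s /Te Ts; have iws := integrable_weight Ts.
  have -> : (fun x => weight theta x * expR (s * (Gamma x 0 j - m))) =
      (fun x => expR (- s * m) * weight (theta + s *: delta_mx 0 j) x).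
    by apply/funext => x; rewrite tiltE.
  split; first exact: (integrableZl mO _ iws).
  by rewrite RintegralZl//; exact: argmin_KL_tilt.
move=> iwY wY0; have iw := integrable_weight Tt.
have imw : mu.-integrable Omega (EFin \o (fun x => m * weight theta x)).
  exact: (integrableZl mO m iw).
(* [F] is [Gamma_j * weight theta] split around [m]: the centred part integrates to 0, leaving
   [m * Z theta]. *)
pose F x := weight theta x * (Gamma x 0 j - m) + m * weight theta x.
have iF : mu.-integrable Omega (EFin \o F) by exact: (integrableD mO iwY imw).
have Z0 := partition_gt0 Tt.
transitivity (\int[mu]_(x in Omega) ((Z theta)^-1 * F x)%:E)%E.
  apply: eq_integral => x _; congr EFin.
  rewrite /exp_density log_partitionE// expRD expRN lnK// /F; ring.
have iZF : mu.-integrable Omega (EFin \o (fun x => (Z theta)^-1 * F x)).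
  exact: (integrableZl mO _ iF).
rewrite -(fineK (integrable_fin_num mO iZF)); congr EFin.
rewrite -/(Rintegral _ _ _) RintegralZl// RintegralD// wY0 add0r RintegralZl//.
by rewrite mulrCA mulVf ?mulr1// gt_eqF.
Qed.

End moment_equation.

(** The exponent stays in [[- K, K]], so the partition function lies between two positive multiples
    of [mu Omega]. The upper bound excludes [+oo], and the lower one excludes 0, where [lne] is
    infinite. *)
Lemma natural_parameters_bounded d (T : measurableType d) (R : realType)
    (mu : {measure set T -> \bar R}) (Omega : set T) (p : nat)
    (Gamma : T -> 'rV[R]_p) :
  measurable Omega -> (0 < mu Omega)%E -> (mu Omega < +oo)%E ->
  (forall j, measurable_fun Omega (fun x => Gamma x 0 j)) ->
  (exists C : R, forall j x, Omega x -> `|Gamma x 0 j| <= C) ->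
  natural_parameters mu Omega Gamma = setT.
Proof.
move=> mO O0 Ooo mG [C GC]; apply/seteqP; split=> // t _.
pose K := \sum_(j < p) `|t 0 j| * C.
have dotK x : Omega x -> `|dotp t (Gamma x)| <= K.
  by move=> Ox; apply: norm_dotp_le => j; exact: GC.
have mw : measurable_fun Omega (fun x => (expR (dotp t (Gamma x)))%:E).
  by apply/measurable_EFinP; exact: measurable_weight.
have up : (\int[mu]_(x in Omega) (expR (dotp t (Gamma x)))%:E <=
    (expR K)%:E * mu Omega)%E.
  rewrite -integral_cst//; apply: ge0_le_integral => //.
  move=> x Ox; rewrite lee_fin ler_expR.
  by apply: le_trans (dotK x Ox); exact: ler_norm.
have lo : ((expR (- K))%:E * mu Omega <=
    \int[mu]_(x in Omega) (expR (dotp t (Gamma x)))%:E)%E.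
  rewrite -integral_cst//; apply: ge0_le_integral => //.
    by move=> x _; rewrite lee_fin expR_ge0.
  move=> x Ox; rewrite lee_fin ler_expR.
  by have := dotK x Ox; rewrite ler_norml => /andP[].
have Zoo : (\int[mu]_(x in Omega) (expR (dotp t (Gamma x)))%:E < +oo)%E.
  by apply: le_lt_trans up _; rewrite lte_mul_pinfty// lee_fin expR_ge0.
have Z0 : (0 < \int[mu]_(x in Omega) (expR (dotp t (Gamma x)))%:E)%E.
  by apply: lt_le_trans lo; rewrite mule_gt0// lte_fin expR_gt0.
rewrite /natural_parameters /log_partition /=.
case: (integral _ _ _) Z0 Zoo => // r; rewrite lte_fin => r0 _.
by rewrite lne_EFin.
Qed.

(** * Finite measure, bounded statistics and shrinking cells *)

Section solution_space_facts.
Variables (R : realType) (d : nat).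
Implicit Types X A : set (euclid R d).

Lemma solution_measure_ltey X A : solution_space X -> measurable A ->
  A `<=` X -> (solution_measure X A < +oo)%E.
Proof.
move=> [_ Xfin] mA AX; rewrite /solution_measure.
case: ifPn => [/asboolP fX|/asboolP nfX].
  rewrite /= /mscale /= /counting ifT ?lte_mul_pinfty ?ltry//.
  by apply/asboolP; exact: sub_finite_set fX.
have [//|[mX _ Xoo]] := Xfin.
by apply: le_lt_trans Xoo; apply: le_measure; rewrite ?inE.
Qed.

Lemma norm_coord_le (v : 'rV[R]_d.+1) i : `|v 0 i| <= `|v|.
Proof.
rewrite [leRHS](mx_normrE v).
exact: (le_bigmax 0 (fun ij : 'I_1 * 'I_d.+1 => `|v ij.1 ij.2|) (0, i)).
Qed.

(** [X] need not be closed, so compactness is taken from a closed cube containing it. *)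
Lemma continuous_bounded_on (X : set 'rV[R]_d.+1) (g : 'rV[R]_d.+1 -> R) :
  bounded_set X -> continuous g -> exists C, forall x, X x -> `|g x| <= C.
Proof.
move=> /ex_strict_bound_gt0[M M0 XM] cg.
pose K : set 'rV[R]_d.+1 := [set v | forall i, `[- M, M]%classic (v ord0 i)].
have Kcpt : compact K.
  apply: (@rV_compact _ _ (fun=> `[- M, M]%classic)) => _.
  exact: segment_compact.
have gK : compact (g @` K).
  by apply: continuous_compact Kcpt; exact: continuous_subspaceT.
have [C C0 gC] := ex_strict_bound_gt0 (compact_bounded gK).
exists C => x /XM /= xM; apply/ltW/gC; exists x => // i /=.
rewrite in_itv/= -ler_norml; apply: le_trans (norm_coord_le _ _) _; exact: ltW.
Qed.

Lemma norm2_coord_le (v : 'rV[R]_d.+1) i : `|v 0 i| <= norm2 v.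
Proof.
rewrite -sqrtr_sqr ler_wsqrtr// (bigD1 i)//= lerDl.
by apply: sumr_ge0 => j _; exact: sqr_ge0.
Qed.

(** Coordinates pass from the Euclidean norm in [diam] to the sup-norm balls of the topology. *)
Lemma mesh_coord_dist (m : nat) (A : 'I_m -> set 'rV[R]_d.+1) (i : 'I_m)
    (u v : 'rV[R]_d.+1) (k : 'I_d.+1) :
  A i u -> A i v -> (`|u 0 k - v 0 k|%:E <= mesh A)%E.
Proof.
move=> Au Av; apply: (@le_trans _ _ (diam (A i))); last exact: le_bigmax.
apply: le_ereal_sup_tmp; exists (norm2 (u - v))%:E; first by exists (u, v).
by rewrite lee_fin; have := norm2_coord_le (u - v) k; rewrite !mxE.
Qed.

(** Once the mesh is below a continuity radius [r] of [g] at [xs], the whole cell containing [xs]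
    lies in the ball of radius [r]. *)
Lemma continuous_mesh (I : nat -> nat)
    (A : forall k, 'I_(I k) -> set 'rV[R]_d.+1) (i : forall k, 'I_(I k))
    (g : 'rV[R]_d.+1 -> R) (xs : 'rV[R]_d.+1) (e : R) :
  mesh (A k) @[k --> \oo] --> 0%E -> (forall k, A k (i k) xs) ->
  continuous g -> 0 < e ->
  \forall k \near \oo, forall x, A k (i k) x -> `|g x - g xs| <= e.
Proof.
move=> mesh0 Axs cg e0.
have /nbhs_ballP[r /= r0 rg] : \forall x \near xs, `|g xs - g x| <= e.
  by move/cvgrPdist_le: (cg xs); exact.
have : \forall k \near \oo, (mesh (A k) < r%:E)%E.
  apply: (mesh0 [set y | (y < r%:E)%E]); apply: open_ereal_lt'.
  by rewrite lte_fin.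
apply: filterS => k mr x Ax; rewrite distrC; apply: rg; split=> // a b.
rewrite ord1 /ball/= -lte_fin; apply: le_lt_trans mr; exact: mesh_coord_dist.
Qed.

End solution_space_facts.

Theorem theorem3p1 (R : realType) (d n p : nat)
  (X : set (euclid R d)) (f : 'I_n -> euclid R d -> R)
  (Omega : set (euclid R d)) (Gamma : 'rV[R]_d.+1 -> 'rV[R]_p)
  (gamma : nat -> R) (I : nat -> nat)
  (A : forall k : nat, 'I_(I k) -> set (euclid R d))
  (theta : forall k : nat, 'I_(I k) -> 'rV[R]_p) :
  let nu := solution_measure X in
  let Theta := natural_parameters nu Omega Gamma in
  solution_space X ->
  (forall x, X x -> measurable (dominating_set X f x)) ->
  measurable Omega -> X `<=` Omega ->
  continuous Gamma ->
  interior Theta !=set0 ->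
  (forall k, 0 < gamma k <= 1) ->
  nonincreasing_seq gamma ->
  (forall k, partition setT (A k) (level_set X f (gamma k))) ->
  (forall k i, measurable (A k i)) ->
  gamma @ \oo --> 0 ->
  mesh (A k) @[k --> \oo] --> 0%E ->
  (forall k i, (0 < nu (A k i))%E) ->
  (forall k i, is_argmin_KL nu Omega Gamma (uniform_density nu (A k i))
                 (theta k i)) ->
  Omega = X \/ (forall k i, interior Theta (theta k i)) ->
  forall xstar, optimal_set X f xstar ->
  exists i : forall k : nat, 'I_(I k),
    forall j : 'I_p,
      expect nu Omega (exp_density nu Omega Gamma (theta k (i k)))
        (fun x => Gamma x 0 j) @[k --> \oo] --> (Gamma xstar 0 j)%:E.
Proof.
move=> nu Theta sX _ mO XO cG _ gamma01 _ part mA _ mesh0 A0 argmin interior_or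
  xstar [Xxs Dxs].
have bX := sX.1.
have AX k i : A k i `<=` X.
  have [cover _ _] := part k => x Ax.
  suff [] : level_set X f (gamma k) x by [].
  by rewrite -cover; exists i.
have /(_ _)/cid icell k : exists i, A k i xstar.
  have [cover _ _] := part k.
  have : level_set X f (gamma k) xstar.
    by split=> //; rewrite Dxs ltW//; have /andP[] := gamma01 k.
  by rewrite -cover => -[i _ Aixs]; exists i.
pose i k := projT1 (icell k).
have Aixs k : A k (i k) xstar := projT2 (icell k).
have cGj j : continuous (fun x => Gamma x 0 j).
  move=> x; apply: (@continuous_comp _ _ _ Gamma (fun M : 'rV[R]_p => M 0 j)).
    exact: cG.
  exact: coord_continuous.
have mGj j : measurable_fun Omega (fun x => Gamma x 0 j).
  by apply: measurable_funTS; exact: continuous_measurable_euclid.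
(* One constant serves all coordinates: the sum of the [|C j|] exceeds each of them. *)
have [C GC] : exists C : R, forall j x, X x -> `|Gamma x 0 j| <= C.
  have /choice[C GC] j := continuous_bounded_on bX (cGj j).
  exists (\sum_(j < p) `|C j|) => j x Xx.
  apply: le_trans (GC j x Xx) _; apply: le_trans (ler_norm _) _.
  by rewrite (bigD1 j)//= lerDl sumr_ge0.
have Aoo k j : (nu (A k j) < +oo)%E by exact: solution_measure_ltey.
have theta_int k j : interior Theta (theta k j).
  have [OX|//] := interior_or.
  suff -> : Theta = setT by rewrite interiorT.
  apply: natural_parameters_bounded => //.
  (* [nu Omega] is positive because [Omega] contains a cell of positive measure. *)
  - apply: lt_le_trans (A0 k j) _; apply: le_measure; rewrite ?inE//.
    by rewrite OX.
  - by apply: solution_measure_ltey => //; rewrite OX.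
  - by exists C => l x; rewrite OX; exact: GC.
exists i => j.
have bA k : exists C : R, forall j x, A k (i k) x -> `|Gamma x 0 j| <= C.
  by exists C => l x /AX; exact: GC.
have AO k : A k (i k) `<=` Omega by exact: subset_trans (AX _ _) XO.
(* The moment equation turns the expectations into means over the chosen cells, which are real
   numbers; the limit can then be taken in [R]. *)
under eq_fun do rewrite (argmin_KL_moment mO mGj (mA _ _) (AO _) (A0 _ _)
  (Aoo _ _) (bA _) j (argmin _ _) (theta_int _ _)).
apply: cvg_EFin; first exact: nearW.
apply/cvgrPdist_le => e e0.
have := continuous_mesh mesh0 Aixs (cGj j) e0.
apply: filterS => k Ake; rewrite /= distrC.
exact: expect_uniform_dist.
Qed.
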